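(* Let $p$ be a prime and let $n\ge m\ge 1$ and $s\ge 1$ be integers. Then \[ E(n\times m,p^s,p^s)=\sum_{k=0}^{m-1}\Phi(p^s,k)\binom{m}{k}_p\binom{s-1}{m-1-k}_p\,p^{a(m,k)s+b(m,k)}, \] where \[ \Phi(p^s,k)=\varphi_{n-(m-1)}(p^{m-1-k})\prod_{u=k}^{m-2}\varphi_{n-u}(p^{s-1})\prod_{v=0}^{k-1}\varphi_{n-v}(p^s) \] (empty products equal $1$), $a(m,k)=\frac{m(m-1)}{2}-(m-1-k)$ and $b(m,k)=\frac{(m-k)(m-3k-1)}{2}$.
   Context: $\mathbb{Z}_{p^s}$ denotes the ring of integers modulo $p^s$. $E(n\times m,p^s,p^j)$ is the number of $n\times m$ matrices $A$ with entries in $\mathbb{Z}_{p^s}$ such that the homogeneous system $Ax\equiv 0\pmod{p^s}$ has exactly $p^j$ solutions $x\in\mathbb{Z}_{p^s}^m$. For positive integers $u,c$, $\varphi_u(c)$ is the number of $u$-tuples $(a_1,\dots,a_u)$ with $1\le a_i\le c$ such that at least one $a_i$ is relatively prime to $c$ (so $\varphi_u(p^t)=p^{u(t-1)}(p^u-1)$ for $t\ge1$ and $\varphi_u(1)=1$). The Gaussian binomial coefficient is $\binom{N}{k}_q=\frac{(1-q^N)\cdots(1-q^{N-k+1})}{(1-q)\cdots(1-q^k)}$ for integers $1\le k\le N$, $\binom{N}{0}_q=1$, and $\binom{N}{k}_q=0$ for $k>N$. *)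

(* Defs.v *)
From mathcomp Require Import all_boot all_order all_algebra.

Set Implicit Arguments.
Unset Strict Implicit.
Unset Printing Implicit Defensive.

Import Order.TTheory GRing.Theory Num.Theory.
Local Open Scope ring_scope.

(* Number of n x m matrices A over Z/N such that A x = 0 has exactly M
   solutions x.  Only meaningful for 1 < N, since 'Z_0 and 'Z_1 are Z/2. *)
Definition E (n m N M : nat) : nat :=
  #|[set A : 'M['Z_N]_(n, m) |
      #|[set x : 'cV['Z_N]_m | A *m x == 0]| == M]|.

(* The entry a_i, which ranges over 1..c, is encoded as (a i).+1 with
   a i : 'I_c. *)
Definition phi (u c : nat) : nat :=
  #|[set a : {ffun 'I_u -> 'I_c} | [exists i, coprime (a i).+1 c]]|.

Definition gbinom (N k : nat) (q : rat) : rat :=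
  if (k <= N)%N then
    (\prod_((N - k).+1 <= i < N.+1) (1 - q ^+ i)) /
    (\prod_(1 <= i < k.+1) (1 - q ^+ i))
  else 0.

Definition Phi (n m p s k : nat) : nat :=
  (phi (n - (m - 1)) (p ^ (m - 1 - k)) *
   \prod_(k <= u < m - 1) phi (n - u) (p ^ (s - 1)) *
   \prod_(0 <= v < k) phi (n - v) (p ^ s))%N.

(* Both dividends below are even, so the integer divisions are exact. *)
Definition expa (m k : nat) : int :=
  ((m%:Z * (m%:Z - 1)) %/ 2)%Z - (m%:Z - 1 - k%:Z).

Definition expb (m k : nat) : int :=
  (((m%:Z - k%:Z) * (m%:Z - 3 * k%:Z - 1)) %/ 2)%Z.

(* Main.v *)
Require Import Defs.
From mathcomp Require Import all_boot all_order all_algebra.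
From mathcomp Require Import zify ring.

Set Implicit Arguments.
Unset Strict Implicit.
Unset Printing Implicit Defensive.

Import Order.TTheory GRing.Theory Num.Theory.

(* Gaussian elimination, one column at a time: over a local ring, either the
   column contains a unit, and clearing its row and column leaves a matrix of
   size (n - 1) x (m - 1) with the same kernel size, or all its entries are
   nonunits.  Once all entries of a matrix over Z/p^(s+1) are nonunits it is p
   times a matrix over Z/p^s, whose kernel is p^m times smaller.  For a kernel
   of size p^j with j < s these two recursions have a product as their
   solution, by the Pascal identity for Gaussian binomials.  For a kernel of
   size p^s, unrolling the elimination until no column contains a unit gives a
   sum over the number k of pivots; the remaining (n - k) x (m - k) matrix is p
   times a matrix over Z/p^(s-1) with a kernel of size p^(s-(m-k)), hence is
   counted by the product, unless m - k = 1, in which case it is zero. *)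

(** * Entrywise counting of matrices, and [phi] at prime powers *)

Lemma card_mx_family (T : finType) n m (F : 'I_n -> 'I_m -> {pred T}) :
  #|[set A : 'M[T]_(n, m) | [forall i, forall j, A i j \in F i j]]| =
  (\prod_i \prod_j #|F i j|)%N.
Proof.
rewrite pair_bigA /=.
have -> : (\prod_(k : 'I_n * 'I_m) #|F k.1 k.2|)%N =
    #|family (fun k : 'I_n * 'I_m => F k.1 k.2)|.
  by rewrite card_family foldrE big_map big_enum.
pose f (A : 'M[T]_(n, m)) := [ffun k : 'I_n * 'I_m => A k.1 k.2].
have f_inj : injective f.
  move=> A B /ffunP eqAB; apply/matrixP => i j.
  by have := eqAB (i, j); rewrite !ffunE.
rewrite -(card_imset _ f_inj); apply: eq_card => g.
apply/imsetP/familyP => [[A] | Fg].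
  rewrite inE => /forallP FA -> [i j]; rewrite ffunE /=.
  by move/forallP: (FA i).
exists (\matrix_(i, j) g (i, j))%R.
  rewrite inE; apply/forallP => i; apply/forallP => j.
  by rewrite mxE; apply: Fg (i, j).
by apply/ffunP => -[i j]; rewrite ffunE mxE.
Qed.

(** The elements are the [t * N + r] with [t < k]. [K] is kept apart from [k * N] because the order
    of ['Z_N] appears as [(Zp_trunc N).+2]. *)
Lemma card_modn_eq K k N r : K = (k * N)%N -> (r < N)%N ->
  #|[set i : 'I_K | (i %% N == r)%N]| = k.
Proof.
move=> -> lt_rN; have N_gt0 : (0 < N)%N by apply: leq_ltn_trans lt_rN.
have bnd (t : 'I_k) : (t * N + r < k * N)%N.
  apply: (@leq_trans (t.+1 * N)); first by rewrite mulSn addnC ltn_add2r.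
  by rewrite leq_mul2r ltn_ord orbT.
pose f t := Ordinal (bnd t).
have f_inj : injective f.
  move=> t u /(congr1 val) /= /addIn /eqP.
  by rewrite eqn_mul2r -leqn0 leqNgt N_gt0 /= => /eqP /val_inj.
rewrite -[RHS]card_ord -cardsT -(card_imset _ f_inj); apply: eq_card => i.
apply/idP/imsetP => [| [t _ ->]]; last first.
  by rewrite inE /= modnMDl modn_small.
rewrite inE => /eqP ri; have lti : (i %/ N < k)%N by rewrite ltn_divLR.
by exists (Ordinal lti) => //; apply: val_inj; rewrite /= -ri -divn_eq.
Qed.

Lemma dvdnS_modn p i : (0 < p)%N -> (p %| i.+1) = (i %% p == p.-1).
Proof.
case: p => // p _ /=.
by have := eqn_modDr 1 i p p.+1; rewrite !addn1 modnn (modn_small (ltnSn p)).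
Qed.

Lemma card_ord_dvdS p t : (0 < p)%N ->
  #|[set i : 'I_(p ^ t.+1) | (p %| i.+1)%N]| = (p ^ t)%N.
Proof.
move=> p_gt0; rewrite -(@card_modn_eq (p ^ t.+1) (p ^ t) p p.-1) ?expnSr //.
  by apply: eq_card => i; rewrite !inE dvdnS_modn.
by rewrite prednK.
Qed.

(** A tuple fails exactly when p divides all its entries, and p divides p^t of the numbers from 1 to
    p^(t+1). *)
Lemma phi_pX p u t : prime p ->
  phi u (p ^ t.+1) = ((p ^ t.+1) ^ u - (p ^ t) ^ u)%N.
Proof.
move=> p_pr; rewrite /phi.
set P := [set a | _].
have := cardsC P; rewrite card_ffun !card_ord => /(congr1 (subn^~ #|~: P|)).
rewrite addnK => ->; congr (_ - _)%N.
pose D := [set i : 'I_(p ^ t.+1) | (p %| i.+1)%N].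
transitivity #|ffun_on (mem D) : {pred {ffun 'I_u -> _}}|; last first.
  by rewrite card_ffun_on card_ord card_ord_dvdS ?prime_gt0.
apply: eq_card => a; rewrite !inE negb_exists.
apply/forallP/ffun_onP => Pa i; have := Pa i;
  by rewrite inE coprime_sym coprime_pexpl // prime_coprime // negbK.
Qed.

Local Open Scope ring_scope.

(** * Elimination and kernel counts over a finite local ring *)

Section PivotRecursion.

Variable R : finComUnitRingType.
Hypothesis nonunitD :
  forall x y : R, x \isn't a GRing.unit -> y \isn't a GRing.unit ->
  x + y \isn't a GRing.unit.

Definition card_ker n m (A : 'M[R]_(n, m)) : nat :=
  #|[set x : 'cV[R]_m | A *m x == 0]|.

(** Columns are examined from right to left and [b] counts those still to be examined: [b = m] is no
    condition, and [b = 0] means that no unit is left. *)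
Definition nonunit_from n m b (A : 'M[R]_(n, m)) : bool :=
  [forall i, forall j : 'I_m, (b <= j)%N ==> (A i j \isn't a GRing.unit)].

Definition count_ker n m b M : nat :=
  #|[set A : 'M[R]_(n, m) | nonunit_from b A && (card_ker A == M)]|.

Let d := #|[set x : R | x \isn't a GRing.unit]|.

Lemma nonunit_fromP n m b (A : 'M[R]_(n, m)) :
  reflect (forall i (j : 'I_m), (b <= j)%N -> A i j \isn't a GRing.unit)
          (nonunit_from b A).
Proof.
apply: (iffP forallP) => [A_b i j le_bj | A_b i].
  by have /forallP/(_ j)/implyP := A_b i; apply.
by apply/forallP => j; apply/implyP; apply: A_b.
Qed.

Lemma nonunitM (x y : R) : y \isn't a GRing.unit -> x * y \isn't a GRing.unit.
Proof. by rewrite unitrM => /negPf->; rewrite andbF. Qed.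

Lemma card_nonunit_from n m b : (b <= m)%N ->
  #|[set A : 'M[R]_(n, m) | nonunit_from b A]| =
  ((#|R| ^ b * d ^ (m - b)) ^ n)%N.
Proof.
move=> le_bm.
pose F (i : 'I_n) (j : 'I_m) : {pred R} :=
  [pred x | (b <= j)%N ==> (x \isn't a GRing.unit)].
have -> : #|[set A : 'M[R]_(n, m) | nonunit_from b A]| =
    (\prod_i \prod_j #|F i j|)%N by rewrite -card_mx_family.
rewrite (eq_bigr (fun=> \prod_(0 <= j < m) if b <= j then d else #|R|))%N.
  rewrite big_const_ord iter_muln_1; congr (_ ^ _)%N.
  rewrite (@big_cat_nat _ _ _ b) //=; congr (_ * _)%N.
    rewrite -[b in RHS]subn0 -prod_nat_const_nat; apply: eq_big_nat => j.
    by case/andP=> _; rewrite ltnNge => /negPf->.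
  by rewrite -prod_nat_const_nat; apply: eq_big_nat => j /andP[-> _].
move=> i _; rewrite big_mkord; apply: eq_bigr => j _; case: ifP => le_bj.
  by rewrite /d cardsE; apply: eq_card => x; rewrite !inE le_bj.
by apply: eq_card => x; rewrite !inE le_bj.
Qed.

(** Elimination run backwards: [c] is column [j0], [rB.1] the rest of the pivot row, and [rB.2] the
    Schur complement of the pivot [c i0 0]. *)
Definition pivot_mx n m (c : 'cV[R]_n.+1) i0 (j0 : 'I_m.+1)
    (rB : 'rV[R]_m * 'M[R]_(n, m)) : 'M[R]_(n.+1, m.+1) :=
  \matrix_(i, j)
    if unlift j0 j is Some j' then
      c i 0 / c i0 0 * rB.1 0 j' +
      (if unlift i0 i is Some i' then rB.2 i' j' else 0)
    else c i 0.

Section Pivot.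

Variables (n m b M : nat) (c : 'cV[R]_n.+1) (i0 : 'I_n.+1) (j0 : 'I_m.+1).
Hypothesis c_unit : c i0 0 \is a GRing.unit.
Hypothesis j0_b : j0 = b :> nat.

Let mk := @pivot_mx n m c i0 j0.

Lemma pivot_mx_j0 rB i : mk rB i j0 = c i 0.
Proof. by rewrite mxE unlift_none. Qed.

Lemma pivot_mx_lift0 rB j : mk rB i0 (lift j0 j) = rB.1 0 j.
Proof. by rewrite mxE liftK unlift_none addr0 divrr ?mul1r. Qed.

Lemma pivot_mx_lift rB i j :
  mk rB (lift i0 i) (lift j0 j) =
  c (lift i0 i) 0 / c i0 0 * rB.1 0 j + rB.2 i j.
Proof. by rewrite mxE !liftK. Qed.

Lemma pivot_mx_inj : injective mk.
Proof.
move=> [r B] [r' B'] eq_mk.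
have eq_r : r = r'.
  apply/rowP => j; have /matrixP/(_ i0 (lift j0 j)) := eq_mk.
  by rewrite !pivot_mx_lift0.
subst r'; congr pair; apply/matrixP => i j.
have /matrixP/(_ (lift i0 i) (lift j0 j)) := eq_mk.
by rewrite !pivot_mx_lift /= => /addrI.
Qed.

Lemma pivot_mx_surj A : col j0 A = c -> exists rB, A = mk rB.
Proof.
move=> Ac; have Aj0 i : A i j0 = c i 0 by rewrite -Ac mxE.
pose r := \row_j A i0 (lift j0 j).
exists (r, \matrix_(i, j) (A (lift i0 i) (lift j0 j)
                           - c (lift i0 i) 0 / c i0 0 * r 0 j)).
apply/matrixP => i j; case: (unliftP j0 j) => [j'|] ->; last first.
  by rewrite pivot_mx_j0.
case: (unliftP i0 i) => [i'|] ->; last by rewrite pivot_mx_lift0 mxE.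
by rewrite pivot_mx_lift [in RHS]/= mxE addrC subrK.
Qed.

(** Elimination changes an entry by a multiple of the pivot row entry in the same column, and
    nonunits form an ideal. *)
Lemma pivot_mx_nonunit_from rB :
  nonunit_from b.+1 (mk rB) = nonunit_from b rB.1 && nonunit_from b rB.2.
Proof.
(* [lift j0] skips column [b], so the columns after [b] become the columns from [b] on. *)
have le_b j : (b.+1 <= lift j0 j)%N = (b <= j)%N.
  by rewrite /= /bump j0_b; lia.
apply/nonunit_fromP/andP => [Ab | [/nonunit_fromP rb /nonunit_fromP Bb]].
  have rb : nonunit_from b rB.1.
    apply/nonunit_fromP => i j; rewrite -le_b ord1 -pivot_mx_lift0.
    exact: Ab.
  split=> //; apply/nonunit_fromP => i j lebj; move/nonunit_fromP: rb => rb.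
  have := Ab (lift i0 i) (lift j0 j); rewrite le_b => /(_ lebj).
  rewrite pivot_mx_lift => nuA.
  set x := _ * _ in nuA; rewrite -[rB.2 i j](addKr x).
  by apply: nonunitD => //; rewrite unitrN nonunitM ?rb.
move=> i j; case: (unliftP j0 j) => [j'|] ->; last by rewrite j0_b ltnn.
rewrite le_b => lebj; case: (unliftP i0 i) => [i'|] ->.
  by rewrite pivot_mx_lift nonunitD ?nonunitM ?rb ?Bb.
by rewrite pivot_mx_lift0 rb.
Qed.

Lemma pivot_mx_ker rB (x : 'cV[R]_m.+1) :
  (mk rB *m x == 0) =
  (x j0 0 == - ((c i0 0)^-1 * (rB.1 *m row' j0 x) 0 0))
    && (rB.2 *m row' j0 x == 0).
Proof.
(* Each row is [c i 0] times the normalised pivot equation, plus a row of the Schur complement if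
   [i] is not [i0]. *)
have mulE i : (mk rB *m x) i 0 =
    c i 0 * (x j0 0 + (c i0 0)^-1 * (rB.1 *m row' j0 x) 0 0) +
    (if unlift i0 i is Some i' then (rB.2 *m row' j0 x) i' 0 else 0).
  rewrite mxE (bigD1_ord j0) //= pivot_mx_j0 mulrDr -addrA; congr (_ + _).
  rewrite mulrA !mxE mulr_sumr.
  case: unliftP => [i'|] ->.
    rewrite mxE -big_split /=; apply: eq_bigr => j _.
    by rewrite pivot_mx_lift mulrDl !mxE mulrA.
  rewrite addr0; apply: eq_bigr => j _.
  by rewrite pivot_mx_lift0 !mxE divrr // mul1r.
rewrite -[x j0 0 == _]subr_eq0 opprK.
apply/eqP/andP => [Ax0 | [/eqP x0 /eqP Bx]].
  have x0 : x j0 0 + (c i0 0)^-1 * (rB.1 *m row' j0 x) 0 0 = 0.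
    have := mulE i0; rewrite Ax0 mxE unlift_none addr0 => /esym/eqP.
    by rewrite mulrI_eq0; [move/eqP | apply: mulrI].
  split; first by rewrite x0.
  apply/eqP/colP => i; have := mulE (lift i0 i).
  by rewrite Ax0 x0 liftK mulr0 add0r !mxE.
apply/colP => i; rewrite mulE x0 Bx mulr0 add0r mxE.
by case: unliftP => [i' _|]; rewrite ?mxE.
Qed.

(** Dropping coordinate [j0] is a bijection between the kernels, since the pivot equation recovers
    that coordinate from the others. *)
Lemma card_ker_pivot_mx rB : card_ker (mk rB) = card_ker rB.2.
Proof.
rewrite /card_ker.
set K := [set x | _]; set K' := [set x | _ *m x == 0].
have row'_inj : {in K &, injective (row' j0 : 'cV[R]_m.+1 -> _)}.
  move=> x y; rewrite !inE !pivot_mx_ker.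
  move=> /andP[/eqP x0 _] /andP[/eqP y0 _] xy.
  apply/colP => i; case: (unliftP j0 i) => [i'|] ->.
    by have /colP/(_ i') := xy; rewrite !mxE.
  by rewrite x0 y0 xy.
rewrite -(card_in_imset row'_inj); apply: eq_card => y.
apply/imsetP/idP => [[x] | Ky].
  by rewrite inE pivot_mx_ker => /andP[_ Bx] ->; rewrite inE.
pose x := \col_i (if unlift j0 i is Some i' then y i' 0
                  else - ((c i0 0)^-1 * (rB.1 *m y) 0 0)).
have xy : row' j0 x = y by apply/colP => i; rewrite !mxE liftK.
exists x; rewrite ?xy // inE pivot_mx_ker xy.
by move: Ky; rewrite inE => ->; rewrite mxE unlift_none eqxx.
Qed.

Lemma card_pivot_col : (b <= m)%N ->
  #|[set A : 'M[R]_(n.+1, m.+1) | [&& nonunit_from b.+1 A, card_ker A == M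
                                    & col j0 A == c]]| =
  (#|R| ^ b * d ^ (m - b) * count_ker n m b M)%N.
Proof.
move=> le_bm; rewrite -[X in (X * _)%N]expn1 -card_nonunit_from // /count_ker.
rewrite -cardsX -(card_imset _ pivot_mx_inj); apply: eq_card => A.
apply/idP/imsetP => [| [[r B]]]; rewrite !inE /=.
  case/and3P=> + + /eqP/pivot_mx_surj[rB eqA].
  rewrite eqA pivot_mx_nonunit_from card_ker_pivot_mx => /andP[rb Bb] kB.
  by exists rB => //; rewrite !inE rb Bb.
case/and3P=> rb Bb kB ->; rewrite pivot_mx_nonunit_from rb Bb.
rewrite card_ker_pivot_mx kB /=; apply/eqP/colP => i.
by rewrite mxE pivot_mx_j0.
Qed.

End Pivot.

(** Split on whether column [b] contains a unit. The |R|^(n+1) - d^(n+1) columns that do all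
    contribute equally, whichever unit serves as pivot. *)
Lemma count_ker_pivot n m b M : (b <= m)%N ->
  count_ker n.+1 m.+1 b.+1 M =
  ((#|R| ^ n.+1 - d ^ n.+1) * (#|R| ^ b * d ^ (m - b)) * count_ker n m b M
   + count_ker n.+1 m.+1 b M)%N.
Proof.
move=> le_bm; pose j0 : 'I_m.+1 := inord b.
have j0_b : j0 = b :> nat by rewrite inordK ?ltnS.
pose S :=
  [set A : 'M[R]_(n.+1, m.+1) | nonunit_from b.+1 A && (card_ker A == M)].
pose C := [set c : 'cV[R]_n.+1 | ~~ nonunit_from 0 c].
pose T := [set A in S | col j0 A \in C].
rewrite /count_ker -/S -(cardsID T); congr (_ + _)%N.
  have -> : S :&: T = T by apply/setIidPr/subsetP => A; rewrite inE => /andP[].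
  rewrite -sum1_card (partition_big (fun A => col j0 A) (mem C)) /=; last first.
    by move=> A; rewrite inE => /andP[].
  transitivity (\sum_(c in C) (#|R| ^ b * d ^ (m - b)) * count_ker n m b M)%N.
    apply: eq_bigr => c Cc; have := Cc; rewrite inE.
    rewrite negb_forall => /existsP[i0]; rewrite negb_forall => /existsP[j].
    rewrite leq0n negbK ord1 => c_unit.
    rewrite -(card_pivot_col _ c_unit j0_b) // -sum1_card.
    apply: eq_bigl => A; rewrite !inE -!andbA; congr [&& _, _ & _].
    by case: eqP => [->|]; rewrite ?andbF // andbT; move: Cc; rewrite inE.
  rewrite sum_nat_const mulnA; congr (_ * _ * _)%N.
  have -> : C = ~: [set c | nonunit_from 0 c] by apply/setP => c; rewrite !inE.
  have := cardsC [set c : 'cV[R]_n.+1 | nonunit_from 0 c].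
  rewrite card_mx card_nonunit_from // muln1 mul1n subn0 expn1.
  by move=> <-; rewrite addKn.
apply: eq_card => A; rewrite !inE; case: (card_ker A == M); rewrite ?andbF //.
rewrite !andbT; apply/andP/nonunit_fromP => [[+ A_b] i j | Ab].
  rewrite A_b negbK => /nonunit_fromP Aj0; move/nonunit_fromP: A_b => Ab.
  rewrite leq_eqVlt => /orP[/eqP bj|]; last exact: Ab.
  have -> : j = j0 by apply: val_inj; rewrite /= j0_b.
  by have := Aj0 i 0 (leq0n _); rewrite mxE.
have Ab1 : nonunit_from b.+1 A by apply/nonunit_fromP => i j /ltnW; apply: Ab.
split=> //; rewrite Ab1 /= negbK; apply/nonunit_fromP => i j _.
by rewrite mxE Ab // j0_b.
Qed.

End PivotRecursion.

(** * The rings Z/p^(s+1) and their nonunits *)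

Lemma E_count_ker n m N M : E n m N M = count_ker 'Z_N n m m M.
Proof.
apply: eq_card => A; rewrite !inE.
suff -> : nonunit_from m A by [].
by apply/nonunit_fromP => i j; rewrite leqNgt ltn_ord.
Qed.

Lemma card_Zn N : (1 < N)%N -> #|'Z_N| = N.
Proof. by move=> N_gt1; rewrite card_ord Zp_cast. Qed.

Lemma ltn_Zn N (x : 'Z_N) : (1 < N)%N -> (x < N)%N.
Proof. by move=> N_gt1; rewrite -[X in (_ < X)%N](Zp_cast N_gt1) ltn_ord. Qed.

Section PrimePower.

Variables (p s : nat).
Hypothesis p_pr : prime p.

Lemma pX_gt1 : (1 < p ^ s.+1)%N.
Proof. by rewrite -(exp1n s.+1) ltn_exp2r ?prime_gt1. Qed.

Lemma Zp_nonunitE (x : 'Z_(p ^ s.+1)) :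
  (x \isn't a GRing.unit) = (p %| x)%N.
Proof.
by rewrite -{1}[x]natr_Zp unitZpE ?pX_gt1 // coprime_pexpl // prime_coprime
  // negbK.
Qed.

Lemma Zp_nonunitD (x y : 'Z_(p ^ s.+1)) : x \isn't a GRing.unit ->
  y \isn't a GRing.unit -> x + y \isn't a GRing.unit.
Proof.
rewrite !Zp_nonunitE -[x]natr_Zp -[y]natr_Zp -natrD !natr_Zp.
rewrite val_Zp_nat ?pX_gt1 // => px py; rewrite /dvdn modn_dvdm.
  exact: dvdn_add.
by rewrite expnS dvdn_mulr.
Qed.

Lemma card_Zp_nonunit :
  #|[set x : 'Z_(p ^ s.+1) | x \isn't a GRing.unit]| = (p ^ s)%N.
Proof.
rewrite -(@card_modn_eq (Zp_trunc (p ^ s.+1)).+2 (p ^ s) p 0) ?prime_gt0 //.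
  by apply: eq_card => x; rewrite !inE Zp_nonunitE.
by rewrite Zp_cast ?pX_gt1 // expnSr.
Qed.

End PrimePower.

(** * Matrices divisible by p *)

Section MulP.

Variables (p N N' : nat).
Hypotheses (p_gt0 : (0 < p)%N) (N_gt1 : (1 < N)%N) (defN' : N' = (p * N)%N).

Let N'_gt1 : (1 < N')%N.
Proof. by rewrite defN'; nia. Qed.

(** Multiplication by p as an additive injection of Z/N into Z/pN, whose image is the set of
    multiples of p. *)
Definition mul_lift (x : 'Z_N) : 'Z_N' := (p * x)%:R.

Definition Zp_red (y : 'Z_N') : 'Z_N := (y : nat)%:R.

Lemma val_mul_lift x : mul_lift x = (p * x)%N :> nat.
Proof.
by rewrite val_Zp_nat // modn_small // defN' ltn_pmul2l // ltn_Zn.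
Qed.

Lemma mul_lift_inj : injective mul_lift.
Proof.
move=> x y /(congr1 val) /= /eqP; rewrite !val_mul_lift eqn_pmul2l //.
by move/eqP/val_inj.
Qed.

Lemma mul_lift_nat k : (p * k)%:R = mul_lift k%:R :> 'Z_N'.
Proof.
apply: val_inj; rewrite /= val_mul_lift val_Zp_nat // val_Zp_nat //.
by rewrite defN' muln_modr.
Qed.

Lemma mul_liftD : {morph mul_lift : x y / x + y}.
Proof.
move=> x y; rewrite /mul_lift -natrD -mulnDr.
rewrite -/(mul_lift _) -[x in LHS]natr_Zp -[y in LHS]natr_Zp.
by rewrite -natrD -mul_lift_nat.
Qed.

Lemma mul_lift0 : mul_lift 0 = 0.
Proof. by rewrite /mul_lift muln0. Qed.

(** A projection formula: products with a multiple of p can be computed in Z/N. *)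
Lemma mul_liftM x y : mul_lift x * y = mul_lift (x * Zp_red y).
Proof.
rewrite -[y in LHS]natr_Zp -natrM -mulnA mul_lift_nat natrM natr_Zp.
by [].
Qed.

Lemma card_Zp_red (x : 'Z_N) : #|[set y | Zp_red y == x]| = p.
Proof.
rewrite -(@card_modn_eq (Zp_trunc N').+2 p N x) ?Zp_cast ?ltn_Zn //.
by apply: eq_card => y; rewrite !inE -val_eqE /= val_Zp_nat.
Qed.

(** By injectivity of [mul_lift], y is in the kernel exactly when its reduction is in the kernel of
    [B], and each reduced vector has p^m lifts. *)
Lemma card_ker_mul_lift n m (B : 'M['Z_N]_(n, m)) :
  card_ker (map_mx mul_lift B) = (p ^ m * card_ker B)%N.
Proof.
have kerE (y : 'cV_m) :
    (map_mx mul_lift B *m y == 0) = (B *m map_mx Zp_red y == 0).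
  have mulE : map_mx mul_lift B *m y = map_mx mul_lift (B *m map_mx Zp_red y).
    apply/matrixP => i k; rewrite !mxE (big_morph _ mul_liftD mul_lift0).
    by apply: eq_bigr => j _; rewrite !mxE mul_liftM.
  have lift0 : map_mx mul_lift 0 = 0 :> 'cV_n.
    by apply/matrixP => i k; rewrite !mxE mul_lift0.
  rewrite mulE -[X in _ == X]lift0 inj_eq //.
  move=> u v /matrixP eq_uv; apply/matrixP => i k; apply: mul_lift_inj.
  by have := eq_uv i k; rewrite !mxE.
pose K := [set x : 'cV_m | B *m x == 0].
rewrite /card_ker -/K -sum1_card.
rewrite (partition_big (fun y => map_mx Zp_red y) (mem K)) /=; last first.
  by move=> y; rewrite !inE kerE.
transitivity (\sum_(x in K) p ^ m)%N; last by rewrite sum_nat_const mulnC.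
apply: eq_bigr => x Kx.
pose F (i : 'I_m) (j : 'I_1) : {pred 'Z_N'} := [pred y | Zp_red y == x i j].
transitivity (\prod_i \prod_j #|F i j|)%N.
  rewrite -card_mx_family -sum1_card; apply: eq_bigl => y; rewrite !inE kerE.
  apply/andP/forallP => [[_ /eqP eq_yx] i | Fy].
    by apply/forallP => j; rewrite inE -eq_yx mxE.
  have eq_yx : map_mx Zp_red y = x.
    by apply/matrixP => i j; have /forallP/(_ j)/eqP := Fy i; rewrite mxE.
  by rewrite eq_yx; move: Kx; rewrite inE => ->.
rewrite (eq_bigr (fun=> p)); first by rewrite big_const_ord iter_muln_1.
by move=> i _; rewrite big_ord1 -(card_Zp_red (x i 0)) cardsE.
Qed.

Lemma count_ker_mul_lift n m M :
  (forall y : 'Z_N', (y \isn't a GRing.unit) = (p %| y)%N) ->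
  count_ker 'Z_N' n m 0 M =
  #|[set B : 'M['Z_N]_(n, m) | p ^ m * card_ker B == M]%N|.
Proof.
move=> nonunitE.
have map_inj : injective (map_mx mul_lift : 'M_(n, m) -> _).
  move=> u v /matrixP eq_uv; apply/matrixP => i k; apply: mul_lift_inj.
  by have := eq_uv i k; rewrite !mxE.
rewrite -(card_imset _ map_inj); apply: eq_card => A.
apply/idP/imsetP => [| [B]]; rewrite !inE.
  case/andP=> /nonunit_fromP A_p kerA.
  have eqA : A = map_mx mul_lift (\matrix_(i, j) (A i j %/ p)%:R).
    apply/matrixP => i j; rewrite !mxE -mul_lift_nat mulnC divnK ?natr_Zp //.
    by rewrite -nonunitE A_p.
  exists (\matrix_(i, j) (A i j %/ p)%:R) => //.
  by rewrite inE -card_ker_mul_lift -eqA.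
move=> kerB ->; rewrite card_ker_mul_lift kerB andbT.
by apply/nonunit_fromP => i j _; rewrite nonunitE mxE val_mul_lift dvdn_mulr.
Qed.

End MulP.

(** * Gaussian binomials and their two Pascal identities *)

Section GaussianBinomial.

Variable q : rat.
Hypothesis q_gt1 : 1 < q.

Let qfact n : rat := \prod_(1 <= i < n.+1) (1 - q ^+ i).

Lemma subr1_expr_neq0 i : 1 - q ^+ i.+1 != 0.
Proof. by rewrite subr_eq0 lt_eqF // exprn_egt1. Qed.

Let qfactS n : qfact n.+1 = qfact n * (1 - q ^+ n.+1).
Proof. by rewrite /qfact big_nat_recr. Qed.

Let qfact_neq0 n : qfact n != 0.
Proof.
elim: n => [|n IHn]; first by rewrite /qfact big_nil.
by rewrite qfactS mulf_neq0 ?subr1_expr_neq0.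
Qed.

Lemma gbinom_small N k : (N < k)%N -> gbinom N k q = 0.
Proof. by rewrite ltnNge /gbinom => /negPf->. Qed.

Let gbinomE k l : gbinom (k + l) k q = qfact (k + l) / (qfact k * qfact l).
Proof.
rewrite /gbinom leq_addr addKn invfM mulrA mulrAC; congr (_ / _).
apply: (canRL (mulfK (qfact_neq0 l))).
by rewrite mulrC /qfact -big_cat_nat // ltnS leq_addl.
Qed.

Lemma gbinom0 N : gbinom N 0 q = 1.
Proof. by rewrite -[N]add0n gbinomE {2}/qfact big_nil mul1r divff. Qed.

Lemma gbinom_sym N k : (k <= N)%N -> gbinom N (N - k) q = gbinom N k q.
Proof.
move/subnKC; set l := (N - k)%N => <-.
by rewrite {1}addnC !gbinomE addnC [qfact l * _]mulrC.
Qed.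

Lemma gbinomn n : gbinom n n q = 1.
Proof. by rewrite -{2}[n]subn0 gbinom_sym // gbinom0. Qed.

Lemma gbinomS N k : (k <= N)%N ->
  gbinom N.+1 k.+1 q = gbinom N k.+1 q + q ^+ (N - k) * gbinom N k q.
Proof.
move/subnKC; set l := (N - k)%N => <-; rewrite -addSn.
have k0 := qfact_neq0 k; have l0 := qfact_neq0 l.
have k1 := subr1_expr_neq0 k.
have Sk0 := subr1_expr_neq0.
(* For [k = N] the term [gbinom k k.+1] is 0 by convention, not by the quotient of q-factorials. *)
case: l l0 => [|l] l0.
  by rewrite !addn0 (@gbinom_small k k.+1) // add0r expr0 mul1r !gbinomn.
have l1 := subr1_expr_neq0 l; have l0' := qfact_neq0 l.
rewrite (gbinomE k.+1 l.+1) (gbinomE k l.+1).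
rewrite -[(k + l.+1)%N]addSnnS (gbinomE k.+1 l) !addSn addnS !qfactS.
rewrite !exprS ?exprD in l1 k1 *.
by field; rewrite k0 l0' k1 l1.
Qed.

Lemma gbinomS' N k : (k <= N)%N ->
  gbinom N.+1 k.+1 q = q ^+ k.+1 * gbinom N k.+1 q + gbinom N k q.
Proof.
rewrite leq_eqVlt => /predU1P[->|lt_kN].
  have := @gbinomS N N (leqnn N); rewrite subnn expr0 mul1r => ->.
  by rewrite gbinom_small // mulr0.
have le_kN := ltnW lt_kN.
rewrite -gbinom_sym // subSS -subnSK // gbinomS; last by lia.
rewrite subnSK // gbinom_sym // addrC; congr (_ * _ + _).
  by congr (_ ^+ _); lia.
exact: gbinom_sym.
Qed.

End GaussianBinomial.

(** * Extreme kernel sizes *)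

Lemma card_ker_gt0 (R : finComUnitRingType) n m (A : 'M[R]_(n, m)) :
  (0 < card_ker A)%N.
Proof. by apply/card_gt0P; exists 0; rewrite inE mulmx0. Qed.

Lemma card_ker0 (R : finComUnitRingType) n m :
  card_ker (0 : 'M[R]_(n, m)) = (#|R| ^ m)%N.
Proof.
rewrite -[m in RHS]muln1 -card_mx -cardsT; apply: eq_card => x.
by rewrite !inE mul0mx eqxx.
Qed.

(** A full kernel contains the standard basis vectors, so every column vanishes. *)
Lemma card_ker_full (R : finComUnitRingType) n m (A : 'M[R]_(n, m)) :
  (card_ker A == #|R| ^ m)%N = (A == 0).
Proof.
apply/eqP/eqP => [kerA | ->]; last exact: card_ker0.
have /setP kerT : [set x : 'cV_m | A *m x == 0] = setT.
  by apply/eqP; rewrite eqEcard subsetT /= cardsT card_mx muln1 -kerA.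
apply/matrixP => i j; have := kerT (delta_mx j 0).
by rewrite !inE -colE => /eqP/colP/(_ i); rewrite !mxE.
Qed.

Lemma count_ker_full (R : finComUnitRingType) n m b :
  count_ker R n m b (#|R| ^ m)%N = 1%N.
Proof.
rewrite -(cards1 (0 : 'M[R]_(n, m))); apply: eq_card => A.
rewrite !inE card_ker_full andb_idl // => /eqP->.
by apply/nonunit_fromP => i j _; rewrite mxE unitr0.
Qed.

Lemma count_ker_nocol (R : finComUnitRingType) n b M :
  count_ker R n 0 b M = (M == 1%N).
Proof.
case: (eqVneq M 1%N) => [->|neqM1]; first exact: count_ker_full.
apply: eq_card0 => A; rewrite !inE [A]thinmx0 card_ker0 expn0 eq_sym.
by rewrite (negPf neqM1) andbF.
Qed.

(** * Kernel counts over Z/p^(s+1): dividing by p *)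

Section PrimePowerCounts.

Variable p : nat.
Hypothesis p_pr : prime p.

Let p_gt0 := prime_gt0 p_pr.

(** In the field Z/p only 0 is a nonunit, so the zero matrix is the only candidate. *)
Lemma count_ker_Zp1 n m j : count_ker 'Z_(p ^ 1)%N n m 0 (p ^ j)%N = (m == j).
Proof.
have cardZ : #|'Z_(p ^ 1)%N| = p by rewrite card_Zn ?expn1 ?prime_gt1.
have nonunit0 (A : 'M['Z_(p ^ 1)%N]_(n, m)) : nonunit_from 0 A -> A = 0.
  move/nonunit_fromP => A0; apply/matrixP => i j'; have := A0 i j' isT.
  rewrite (@Zp_nonunitE p 0 p_pr) mxE => pA; apply: val_inj => /=.
  apply/eqP; rewrite -leqn0 leqNgt; apply/negP => /dvdn_leq/(_ pA).
  by apply/negP; rewrite -ltnNge (leq_trans (ltn_Zn _ (pX_gt1 0 p_pr))) ?expn1.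
case: eqVneq => [<-|neq_mj].
  by have := count_ker_full 'Z_(p ^ 1)%N n m 0; rewrite cardZ.
apply: eq_card0 => A; rewrite !inE; apply/negP => /andP[/nonunit0->].
by rewrite card_ker0 cardZ eqn_exp2l ?prime_gt1 // (negPf neq_mj).
Qed.

Lemma count_ker_ZpS s n m j :
  count_ker 'Z_(p ^ s.+2)%N n m 0 (p ^ j)%N =
  if (m <= j)%N then count_ker 'Z_(p ^ s.+1)%N n m m (p ^ (j - m))%N else 0%N.
Proof.
rewrite (count_ker_mul_lift p_gt0 (pX_gt1 s p_pr) (expnS p s.+1)); last first.
  exact: Zp_nonunitE.
case: leqP => [le_mj | lt_jm].
  rewrite -E_count_ker /E; apply: eq_card => B; rewrite !inE.
  by rewrite -{1}(subnKC le_mj) expnD eqn_pmul2l ?expn_gt0 ?p_gt0.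
apply: eq_card0 => B; rewrite !inE; apply/negP => /eqP eqB.
have := card_ker_gt0 B; rewrite lt0n => /negP; apply.
have : (p ^ m * card_ker B < p ^ m * 1)%N.
  by rewrite eqB muln1 ltn_exp2l ?prime_gt1.
by rewrite ltn_pmul2l ?expn_gt0 ?p_gt0 // ltnS leqn0.
Qed.

(** * Integer powers of p, and the product formula for kernels smaller than p^(s+1) *)

Let q : rat := p%:R.

Let q_gt1 : 1 < q.
Proof. by rewrite ltr1n prime_gt1. Qed.

Let q_neq0 : q != 0.
Proof. by rewrite gt_eqF // (lt_trans ltr01). Qed.

Let ZqD x y : q ^ (x + y) = q ^ x * q ^ y.
Proof. exact: expfzDr. Qed.

Let mulqA x y z u L S :
  q ^ x * u * q ^ y * (q ^ z * L * S) = q ^ (x + y + z) * (u * L * S).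
Proof. by rewrite !ZqD; ring. Qed.

Let mulqA' x y u L S :
  q ^ x * (u * L) * (q ^ y * S) = q ^ (x + y) * (u * L * S).
Proof. by rewrite !ZqD; ring. Qed.

(** For [t > 0], the number of columns of length [u] over Z/p^t with a unit entry, that is p^(ut) -
    p^(u(t-1)). *)
Let unimod u (t : nat) : rat := q ^ (u%:Z * t%:Z) * (1 - q ^ (- u%:Z)).

Lemma subn_expE u t :
  (((p ^ t.+1) ^ u - (p ^ t) ^ u)%N)%:R = unimod u t.+1.
Proof.
rewrite natrB; last by rewrite -!expnM leq_exp2l ?prime_gt1 // leq_mul.
rewrite /unimod mulrBr mulr1 -ZqD !natrX -!exprM !exprnP.
by congr (q ^ _ - q ^ _); rewrite ?PoszM; lia.
Qed.

Lemma phi_rat u t : (phi u (p ^ t.+1))%:R = unimod u t.+1.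
Proof. by rewrite phi_pX // subn_expE. Qed.

Lemma count_ker_ZpS_pivot s n m b M : (b <= m)%N ->
  (count_ker 'Z_(p ^ s.+1)%N n.+1 m.+1 b.+1 M)%:R =
  unimod n.+1 s.+1 * q ^ (s%:Z * m%:Z + b%:Z)
    * (count_ker 'Z_(p ^ s.+1)%N n m b M)%:R
  + (count_ker 'Z_(p ^ s.+1)%N n.+1 m.+1 b M)%:R :> rat.
Proof.
move=> le_bm; rewrite count_ker_pivot //; last exact: Zp_nonunitD.
rewrite card_Zp_nonunit // card_Zn ?pX_gt1 // natrD natrM natrM subn_expE.
(* The pivot row has [b] free and [m - b] nonunit entries: (s+1) b + s (m-b) = s m + b. *)
congr (_ * _ * _ + _); rewrite natrM !natrX -!exprM -exprD exprnP.
by congr (q ^ _); move: le_bm => /subnKC<-; rewrite addKn; nia.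
Qed.

(** For [m <= n], the proportion of n x m matrices over the field with p elements that have rank
    m. *)
Let rankfact n m : rat := \prod_(0 <= i < m) (1 - q ^ (i%:Z - n%:Z)).

Let rankfactS n m : rankfact n.+1 m.+1 = (1 - q ^ (- n.+1%:Z)) * rankfact n m.
Proof.
rewrite /rankfact big_nat_recl // sub0r; congr (_ * _).
by apply: eq_big_nat => i _; congr (1 - q ^ _); lia.
Qed.

(* The number of sublattices of index p^j in Z_p^m all of whose vectors have
   their coordinates from b on in p Z_p. *)
Let sublattices j m b : rat :=
  if (m <= j + b)%N then gbinom (j + b - 1) (j + b - m) q else 0.

Let sublatticesS j m b : (b <= m)%N ->
  sublattices j m.+1 b.+1 =
  q ^ (j%:Z + b%:Z - m%:Z) * sublattices j m b + sublattices j m.+1 b.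
Proof.
rewrite /sublattices addnS ltnS !subSS subn0 subn1 /=.
case: (ltngtP m (j + b)) => [lt_m | gt_m | eq_m] le_bm; last 2 first.
- by rewrite mulr0 addr0.
- have -> : j%:Z + b%:Z - m%:Z = 0 by lia.
  by rewrite eq_m subnn !gbinom0 // mul1r addr0.
(* As [j + b] is positive here, [j + b - 1] is a true predecessor. *)
have [N defN] : exists N, (j + b = N.+1)%N by exists (j + b).-1; lia.
rewrite subnS; move: lt_m; rewrite defN ltnS => le_mN.
rewrite subSn // gbinomS' ?leq_subr //= exprnP.
by congr (q ^ _ * _ + _); lia.
Qed.

(* The power of p times [rankfact n m] is the number of n-tuples of rows over
   Z/p^(s+1) that generate the image of a given such sublattice. *)
Let regular_count s j n m b : rat :=
  q ^ (n%:Z * (s.+1%:Z * m%:Z - j%:Z)) * rankfact n m * sublattices j m b.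

Let regular_count_nocol s j n : regular_count s j n 0 0 = (j == 0%N)%:R.
Proof.
rewrite /regular_count /rankfact /sublattices big_nil addn0 subn0 mulr1.
case: j => [|j]; first by rewrite gbinom0 // !(mulr0, subr0).
by rewrite gbinom_small ?mulr0 // subn1.
Qed.

(** Both sides satisfy the pivot recursion in [b], so agreement at [b = 0] suffices. *)
Let count_ker_regular_pivot s j :
  (forall n m, (m <= n)%N ->
    (count_ker 'Z_(p ^ s.+1)%N n m 0 (p ^ j)%N)%:R = regular_count s j n m 0) ->
  forall b n m, (b <= m <= n)%N ->
  (count_ker 'Z_(p ^ s.+1)%N n m b (p ^ j)%N)%:R = regular_count s j n m b.
Proof.
move=> count0; elim=> [|b IHb] n m /andP[le_bm le_mn]; first exact: count0.
case: m le_bm le_mn => // m; rewrite ltnS; case: n => // n le_bm le_mn.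
rewrite count_ker_ZpS_pivot // (IHb n m) ?le_bm // (IHb n.+1 m.+1); last first.
  by rewrite (leqW le_bm).
rewrite /regular_count sublatticesS // rankfactS [RHS]mulrDr; congr (_ + _).
by rewrite /unimod mulqA mulqA'; congr (q ^ _ * _); ring.
Qed.

Let count_ker_regular s : forall j n m b, (j < s.+1)%N -> (b <= m <= n)%N ->
  (count_ker 'Z_(p ^ s.+1)%N n m b (p ^ j)%N)%:R = regular_count s j n m b.
Proof.
(* Induction on [s], reduced to [b = 0]. The case [m = 0] is settled first: only with [m > 0] does
   division by p lower [j], as the bound on [j] requires. *)
elim: s => [|s IHs] j n m b lt_js; apply: count_ker_regular_pivot => {b m n} n;
  (case=> [|m] le_mn;
   first by rewrite count_ker_nocol (@eqn_exp2l p j 0) ?prime_gt1 //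
                    regular_count_nocol).
  (* For [s = 0] the bound forces [j = 0], and both sides vanish since there is a column. *)
  move: lt_js; rewrite ltnS leqn0 => /eqP->; rewrite count_ker_Zp1.
  by rewrite /regular_count /sublattices mulr0.
rewrite count_ker_ZpS /regular_count /sublattices addn0.
case: leqP; rewrite ?mulr0 // => le_mj; rewrite IHs ?leqnn //; last by lia.
rewrite /regular_count /sublattices subnK // le_mj; congr (q ^ _ * _ * _).
by rewrite -subzn //; ring.
Qed.

(** * Unrolling the elimination, and kernels of order exactly p^(s+1) *)

Let pivot_exp (s m k : nat) : int :=
  s%:Z * k%:Z * m%:Z + (1 - s%:Z) * 'C(k.+1, 2)%:Z - k%:Z.

(** This sums over pivot columns b > b_1 > ... > b_k >= 0. The sizes m-1, ..., m-k contribute the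
    exponent s (k m - C(k+1,2)); the sum of q^(b_1 + ... + b_k) is q^C(k,2) times [gbinom b k q]. As
    C(k,2) = C(k+1,2) - k, the exponents add up to [pivot_exp]. *)
Lemma pivot_unroll s (h : nat -> nat -> nat -> rat) (u : nat -> rat) :
  (forall n m b, (b <= m)%N ->
     h n.+1 m.+1 b.+1 =
     u n.+1 * q ^ (s%:Z * m%:Z + b%:Z) * h n m b + h n.+1 m.+1 b) ->
  forall b n m, (b <= m <= n)%N ->
  h n m b =
  \sum_(0 <= k < b.+1)
     (\prod_(0 <= v < k) u (n - v)%N) * gbinom b k q * q ^ pivot_exp s m k
     * h (n - k)%N (m - k)%N 0%N.
Proof.
move=> hS; elim=> [|b IHb] n m /andP[le_bm le_mn].
  rewrite big_nat1 big_nil gbinom0 // !subn0 /pivot_exp bin_small //.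
  by rewrite !(mulr0, mul0r, addr0, subr0) expr0z !mul1r.
case: m le_bm le_mn => // m; rewrite ltnS; case: n => // n le_bm le_mn.
rewrite hS // IHb ?le_bm // (IHb n.+1 m.+1); last by rewrite (leqW le_bm).
set F := fun k : nat => (\prod_(0 <= v < k) u (n.+1 - v)%N)
  * q ^ pivot_exp s m.+1 k * h (n.+1 - k)%N (m.+1 - k)%N 0%N.
(* A pivot in column [b] raises the index to [k.+1]; the sum without one is extended by a zero term
   at [b.+1]. *)
transitivity (\sum_(0 <= k < b.+1) q ^+ (b - k) * gbinom b k q * F k.+1
              + \sum_(0 <= k < b.+2) gbinom b k q * F k).
  congr (_ + _); last first.
    rewrite [RHS]big_nat_recr //= gbinom_small // mul0r addr0.
    by apply: eq_bigr => k _; rewrite /F; ring.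
  rewrite mulr_sumr; apply: eq_big_nat => k; rewrite ltnS => /andP[_ le_kb].
  rewrite /F big_nat_recl // subn0 exprnP -subzn // !subSS.
  under [in RHS]eq_bigr do rewrite subSS.
  have -> : forall P g H : rat,
      u n.+1 * q ^ (s%:Z * m%:Z + b%:Z) * (P * g * q ^ pivot_exp s m k * H) =
      q ^ (s%:Z * m%:Z + b%:Z + pivot_exp s m k) * (u n.+1 * P * g * H).
    by move=> P g H; rewrite !ZqD; ring.
  have -> : forall P g H : rat,
      q ^ (b%:Z - k%:Z) * g * (u n.+1 * P * q ^ pivot_exp s m.+1 k.+1 * H) =
      q ^ (b%:Z - k%:Z + pivot_exp s m.+1 k.+1) * (u n.+1 * P * g * H).
    by move=> P g H; rewrite !ZqD; ring.
  congr (q ^ _ * _); rewrite /pivot_exp (binS k.+1) bin1 PoszD.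
  by ring.
rewrite [X in _ + X = _]big_nat_recl // [RHS]big_nat_recl //.
rewrite addrCA -big_split !gbinom0 //=.
congr (_ + _); first by rewrite /F; ring.
apply: eq_big_nat => k; rewrite ltnS => /andP[_ le_kb].
by rewrite gbinomS // /F; ring.
Qed.

Lemma count_ker_Zp1col s n :
  count_ker 'Z_(p ^ s.+1)%N n 1 1 (p ^ s.+1)%N = 1%N.
Proof.
by have := count_ker_full 'Z_(p ^ s.+1)%N n 1 1; rewrite card_Zn ?pX_gt1.
Qed.

(** For [d > 0], division by p leaves a kernel of order p^(s-d) over Z/p^s, within reach of the
    product formula. For [d = 0] the kernel is full and only the zero column counts, whereas the
    product would give 1 - q^(-n). *)
Lemma count_ker_Zp_top s n d : (d < n)%N ->
  (count_ker 'Z_(p ^ s.+1)%N n d.+1 0 (p ^ s.+1)%N)%:R =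
  gbinom s d q *
  (if d == 0%N then 1 else q ^ (n%:Z * (s.+1%:Z * d%:Z)) * rankfact n d.+1).
Proof.
case: s => [|s] lt_dn.
  rewrite count_ker_Zp1; case: d lt_dn => [|d] _.
    by rewrite gbinom0 ?mulr1.
  by rewrite gbinom_small ?mul0r.
rewrite count_ker_ZpS; case: d lt_dn => [|d] lt_dn.
  by rewrite /= subn1 count_ker_Zp1col gbinom0 ?mulr1.
rewrite /= ltnS; case: ltnP => [lt_ds | le_sd]; last first.
  by rewrite gbinom_small ?mul0r.
rewrite count_ker_regular ?leqnn //; last by lia.
rewrite /regular_count /sublattices subnK // ltnS lt_ds mulrC subn1 /= subSS.
rewrite gbinom_sym //; congr (_ * (q ^ _ * _)).
rewrite -subzn //; ring.
Qed.

(** * Matching the pivot sum with [Phi] and the stated exponents *)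

Let prod_unimod n k d t : (k + d <= n)%N ->
  \prod_(k <= u < k + d) unimod (n - u) t =
  q ^ (t%:Z * (d%:Z * (n%:Z - k%:Z) - 'C(d, 2)%:Z)) * rankfact (n - k) d.
Proof.
elim: d => [|d IHd] le_kdn.
  by rewrite /rankfact addn0 !big_geq // bin0n !(mul0r, subr0, mulr0) mulr1.
rewrite addnS big_nat_recr ?leq_addr //= IHd; last by rewrite ltnW // -addnS.
rewrite /rankfact big_nat_recr //= /unimod.
have -> : forall L a b c : rat, a * L * (b * c) = a * b * (L * c).
  by move=> *; ring.
rewrite -ZqD binS bin1; congr (q ^ _ * (_ * (1 - q ^ _))); last by lia.
have -> : (n - (k + d))%N%:Z = n%:Z - k%:Z - d%:Z by lia.
by rewrite PoszD; ring.
Qed.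

Lemma phi_1 u : (0 < u)%N -> phi u 1 = 1%N.
Proof.
move=> u_gt0; transitivity #|[set: {ffun 'I_u -> 'I_1}]|.
  apply: eq_card => a; rewrite !inE; apply/existsP.
  by exists (Ordinal u_gt0); rewrite coprimen1.
by rewrite cardsT card_ffun !card_ord exp1n.
Qed.

(** Writing triangular numbers as binomials removes the divisions by 2 from [expa] and [expb]. *)
Let bin2E k : (k%:Z + 1) * k%:Z = 2 * 'C(k.+1, 2)%:Z.
Proof.
have := mul_bin_diag k.+1 1; rewrite bin1 /= => /(congr1 Posz).
by rewrite !PoszM -addn1 PoszD.
Qed.

Let expaE k d : expa (k + d).+1 k = 'C((k + d).+1, 2)%:Z - d%:Z.
Proof.
rewrite /expa; congr (_ - _); last by lia.
have -> : (k + d).+1%:Z * ((k + d).+1%:Z - 1) = 'C((k + d).+1, 2)%:Z * 2.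
  by rewrite mulrC [RHS]mulrC -bin2E mulrC -addn1 PoszD addrK.
by rewrite mulzK.
Qed.

Let expbE k d : expb (k + d).+1 k = 'C(d.+1, 2)%:Z - k%:Z * (d%:Z + 1).
Proof.
rewrite /expb -[RHS](@mulzK _ 2) //; congr (_ %/ _)%Z.
rewrite [RHS]mulrBl ['C(_, _)%:Z * 2]mulrC -bin2E; ring.
Qed.

Let bin2D k d :
  'C((k + d).+1, 2)%:Z = 'C(k.+1, 2)%:Z + 'C(d.+1, 2)%:Z + k%:Z * d%:Z.
Proof.
apply: (@mulfI _ 2) => //; rewrite -bin2E !mulrDr -!bin2E PoszD; ring.
Qed.

(** Here m = k+d+1. The last product in [Phi] counts the pivot columns; the other two factors give
    the [rankfact] of the remaining block. The value of [phi] at p^0 = 1 accounts for the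
    exceptional case [d = 0]. *)
Let Phi_rat n k d s : (k + d < n)%N -> (d <= s)%N ->
  (Phi n (k + d).+1 p s.+1 k)%:R
    * q ^ (expa (k + d).+1 k * s.+1%:Z + expb (k + d).+1 k) =
  (\prod_(0 <= v < k) unimod (n - v) s.+1) * q ^ pivot_exp s (k + d).+1 k *
  (if d == 0%N then 1
   else q ^ ((n - k)%N%:Z * (s.+1%:Z * d%:Z)) * rankfact (n - k) d.+1).
Proof.
move=> lt_kdn le_ds; rewrite /Phi !subn1 /= addKn !natrM.
set A : rat := (phi _ _)%:R; set B : rat := (\prod_(k <= u < _) _)%:R.
have -> : (\prod_(0 <= v < k) phi (n - v) (p ^ s.+1)%N)%:R =
    \prod_(0 <= v < k) unimod (n - v) s.+1 :> rat.
  by rewrite natr_prod; apply: eq_bigr => v _; rewrite phi_rat.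
suff AB : A * B * q ^ (expa (k + d).+1 k * s.+1%:Z + expb (k + d).+1 k) =
    q ^ pivot_exp s (k + d).+1 k *
    (if d == 0%N then 1
     else q ^ ((n - k)%N%:Z * (s.+1%:Z * d%:Z)) * rankfact (n - k) d.+1).
  by rewrite mulrAC AB mulrC [LHS]mulrA.
have exp_eq : expa (k + d).+1 k * s.+1%:Z + expb (k + d).+1 k =
    pivot_exp s (k + d).+1 k + d%:Z * d%:Z + s%:Z * 'C(d, 2)%:Z.
  apply: subr0_eq; rewrite expaE expbE /pivot_exp bin2D.
  (* The difference of the exponents is a combination of two instances of [bin2E]. *)
  transitivity (s%:Z * (2 * 'C(k.+1, 2)%:Z - (k%:Z + 1) * k%:Z)
                + (2 * 'C(d.+1, 2)%:Z - (d%:Z + 1) * d%:Z)).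
    by rewrite !(binS d) bin1 PoszD; ring.
  by rewrite !bin2E !subrr mulr0 addr0.
rewrite {}exp_eq {}/A {}/B; case: d lt_kdn le_ds => [|d].
  rewrite addn0 => lt_kn _; rewrite expn0 phi_1 ?subn_gt0 //.
  by rewrite big_geq // !mulr1 mul1r bin0n !mulr0 !addr0.
(* Since [d <= s], the case [s = 0] is excluded, so p^s is a proper power and [phi_rat] applies. *)
rewrite addnS; case: s => // s lt_kdn _; rewrite phi_rat natr_prod.
rewrite (eq_bigr (fun u => unimod (n - u) s.+1)); last first.
  by move=> u _; rewrite phi_rat.
rewrite -addnS prod_unimod; last by lia.
(* The last factor of [rankfact] comes from the first factor of [Phi], the others from its middle
   product. *)
rewrite [rankfact _ d.+2]/rankfact big_nat_recr //= -/(rankfact _ _).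
rewrite {1}/unimod.
have -> : forall L a b c d : rat, a * b * (c * L) * d = a * c * d * (L * b).
  by move=> *; ring.
rewrite !mulrA -!ZqD; congr (q ^ _ * _ * (1 - q ^ _)); last by lia.
have -> : (n - (k + d.+1))%N%:Z = n%:Z - k%:Z - d%:Z - 1 by lia.
have -> : (n - k)%N%:Z = n%:Z - k%:Z by lia.
ring.
Qed.

Lemma E_top_sum n m s : (0 < m)%N -> (m <= n)%N -> (0 < s)%N ->
  (E n m (p ^ s) (p ^ s))%:R =
  \sum_(0 <= k < m)
     (Phi n m p s k)%:R * gbinom m k q * gbinom (s - 1) (m - 1 - k) q
     * q ^ (expa m k * s%:Z + expb m k).
Proof.
move=> m_gt0 le_mn; case: s => // s _; rewrite E_count_ker.
pose h n m b : rat := (count_ker 'Z_(p ^ s.+1)%N n m b (p ^ s.+1)%N)%:R.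
rewrite -/(h n m m) (@pivot_unroll s h (fun u => unimod u s.+1)).
(* The term [k = m] vanishes: without columns the kernel has one element, not p^(s+1). *)
- rewrite big_nat_recr //= /h subnn count_ker_nocol.
  rewrite (@eqn_exp2l p s.+1 0) ?prime_gt1 //.
  rewrite mulr0 addr0; apply: eq_big_nat => k /andP[_ lt_km].
  have [d def_m] : exists d, m = (k + d).+1 by exists (m - k).-1; lia.
  rewrite {m m_gt0 lt_km}def_m in le_mn *.
  have -> : ((k + d).+1 - k)%N = d.+1 by lia.
  rewrite count_ker_Zp_top; last by lia.
  rewrite !subn1 /= addKn.
  (* If [d > s], both sides contain the vanishing factor [gbinom s d]. *)
  have [le_ds | lt_sd] := leqP d s; last first.
    by rewrite (gbinom_small _ lt_sd) !(mulr0, mul0r).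
  rewrite [RHS]mulrAC [X in _ = X * _]mulrAC Phi_rat //.
  have swap W G Q g X : W * G * Q * (g * X) = W * Q * X * G * g :> rat by ring.
  exact: swap.
- by move=> n' m' b le_bm; apply: count_ker_ZpS_pivot.
by rewrite leqnn.
Qed.

End PrimePowerCounts.

Theorem theorem5p2 (p n m s : nat) (p_pr : prime p)
    (m_gt0 : (1 <= m)%N) (le_mn : (m <= n)%N) (s_gt0 : (1 <= s)%N) :
  (E n m (p ^ s) (p ^ s))%:R =
  \sum_(0 <= k < m)
     (Phi n m p s k)%:R * gbinom m k p%:R * gbinom (s - 1) (m - 1 - k) p%:R
     * (p%:R : rat) ^ (expa m k * s%:Z + expb m k).
Proof. exact: E_top_sum. Qed.
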